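(* Let $\mathbf u\in\mathcal A$, let $\mathcal I$ be a translation invariant free $P$-ideal of $\mathbb N$, and let $x\in[0,1)$ with $S=\operatorname{supp}(x)$ and $S_b=\operatorname{supp}_b(x)$. If $S$ is $b$-bounded mod $\mathcal I$, then $\bar x\in t_{\mathbf u}^{\mathcal I}(\mathbb T)$ if and only if the following three conditions all hold: (i) $S+1\subseteq^{\mathcal I}S$; (ii) $S_b\subseteq_{\mathcal I}S$; (a2) for every $b$-bounded $A\in\mathcal P(\mathbb N)\setminus\mathcal I$ with $A\cap S\in\mathcal I$, there exists $A'\subseteq_{\mathcal I}A$ such that $\lim_{n\in A'}\frac{c_{n+1}}{b_{n+1}}=0$.
   Context: $\mathbb N=\{0,1,2,\dots\}$, $\mathbb N_+=\mathbb N\setminus\{0\}$, $\mathbb T=\mathbb R/\mathbb Z$ is the circle group, and $\bar x$ is the image of $x\in\mathbb R$ in $\mathbb T$. $\mathcal A$ is the family of arithmetic sequences: strictly increasing sequences of integers $\mathbf u=(u_n)_{n\in\mathbb N}$ with $u_0=1$ and $u_n\mid u_{n+1}$ for all $n$. Put $b_n=u_n/u_{n-1}$ for $n\in\mathbb N_+$. Every $x\in[0,1)$ has a unique representation $x=\sum_{n=1}^\infty c_n/u_n$ with $c_n\in\mathbb N$, $c_n<b_n$ for all $n\in\mathbb N_+$, and $c_n<b_n-1$ for infinitely many $n$; $\operatorname{supp}(x)=\{n\in\mathbb N_+:c_n\ne0\}$, $\operatorname{supp}_b(x)=\{n\in\mathbb N_+:c_n=b_n-1\}$. For $A\subseteq\mathbb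 N$ and $k\in\mathbb Z$, $A+k$ denotes $\{a+k:a\in A\}\cap\mathbb N$. An infinite $A\subseteq\mathbb N$ is $b$-bounded if $(b_n)_{n\in A}$ is bounded (the index $0$ is disregarded); finite sets are also regarded as $b$-bounded. $\lim_{n\in E}$ denotes the limit as $n\to\infty$ along an infinite set $E$. An ideal $\mathcal I$ of $\mathbb N$ is a non-empty family of subsets of $\mathbb N$ closed under finite unions and subsets (not required to be proper); it is free if it contains all finite sets; it is a $P$-ideal if for every countable family $\{A_n\}\subseteq\mathcal I$ there is $A\in\mathcal I$ with $A_n\setminus A$ finite for all $n$; it is translation invariant if $A\in\mathcal I$ implies $A+k\in\mathcal I$ for all $k\in\mathbb Z$. Write $A\subseteq^{\mathcal I}B$ if $A\setminus B\in\mathcal I$, and $A\subseteq_{\mathcal I}B$ if $A\subseteq B$ and $B\setminus A\in\mathcal I$. A set $X\subseteq\mathbb N$ is $b$-bounded mod $\mathcal I$ if there is a $b$-bounded $A\subseteq_{\mathcal I}X$. $t_{\mathbf u}^{\mathcal I}(\mathbb T)$ is the set of $z\in\mathbb T$ such that $\{n\in\mathbb N:u_nz\notin U\}\in\mathcal I$ for every neighborhood $U$ of $0$ in $\mathbb T$. *)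

(* Defs.v *)
From mathcomp Require Import all_boot all_order all_algebra.
From mathcomp Require Import generic_quotient ring_quotient.
From mathcomp Require Import all_classical all_reals all_analysis.

Set Implicit Arguments.
Unset Strict Implicit.
Unset Printing Implicit Defensive.

Import Order.TTheory GRing.Theory Num.Theory.
Import numFieldNormedType.Exports.

Local Open Scope classical_set_scope.
Local Open Scope ring_scope.

(* int_num_subdef is the predicate underlying the qualifier Num.int, and the
   one that carries the subgroup structure. *)
Definition int_subgroup (R : realType) : zmodClosed R :=
  GRing.ZmodClosed.clone R (@Num.int_num_subdef R) _.

Definition circle (R : realType) : Type := {ideal_quot (int_subgroup R)}.

(* The quotient topology lives on the library's alias of the carrier, since
   the latter has no topology of its own. *)
Definition circle_nbhs (R : realType) (z : circle R) : set_system (circle R) :=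
  nbhs (z : quotient_topology {ideal_quot (int_subgroup R)}).

Definition to_circle (R : realType) (x : R) : circle R :=
  \pi_({ideal_quot (int_subgroup R)})%qT x.

Definition arithmetic_seq (u : nat -> int) : Prop :=
  [/\ forall m n, (m < n)%N -> u m < u n,
      u 0%N = 1
    & forall n, (u n %| u n.+1)%Z].

(* b_n = u_n / u_(n-1) for n > 0; the value at n = 0 is never used. *)
Definition quot_ratio (u : nat -> int) (n : nat) : int := (u n %/ u n.-1)%Z.

(* Only the digits c_n with n > 0 are meaningful; c_0 is set to 0 so that the
   representing function is unique. *)
Definition is_representation (R : realType) (u : nat -> int) (x : R)
    (c : nat -> nat) : Prop :=
  [/\ c 0%N = 0%N,
      forall n, (0 < n)%N -> (c n)%:Z < quot_ratio u n,
      infinite_set [set n | (0 < n)%N /\ (c n)%:Z < quot_ratio u n - 1]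
    & series (fun n => (c n.+1)%:R / (u n.+1)%:~R : R) @ \oo --> x].

(* The unique representation of x (when x is in [0, 1[). *)
Definition digit (R : realType) (u : nat -> int) (x : R) : nat -> nat :=
  xget (fun=> 0%N) [set c | is_representation u x c].

Definition supp (R : realType) (u : nat -> int) (x : R) : set nat :=
  [set n | (0 < n)%N /\ digit u x n <> 0%N].

Definition supp_b (R : realType) (u : nat -> int) (x : R) : set nat :=
  [set n | (0 < n)%N /\ (digit u x n)%:Z = quot_ratio u n - 1].

Definition translate (A : set nat) (k : int) : set nat :=
  [set n | exists2 a, A a & n%:Z = a%:Z + k].

(* Finite sets satisfy this condition. *)
Definition b_bounded (u : nat -> int) (A : set nat) : Prop :=
  exists M : int, forall n, A n -> (0 < n)%N -> quot_ratio u n <= M.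

Definition set_ideal (I : set (set nat)) : Prop :=
  [/\ I !=set0,
      forall A B, I A -> I B -> I (A `|` B)
    & forall A B, A `<=` B -> I B -> I A].

Definition free_ideal (I : set (set nat)) : Prop :=
  forall A, finite_set A -> I A.

Definition P_ideal (I : set (set nat)) : Prop :=
  forall F : nat -> set nat, (forall n, I (F n)) ->
    exists2 A, I A & forall n, finite_set (F n `\` A).

Definition translation_invariant (I : set (set nat)) : Prop :=
  forall A (k : int), I A -> I (translate A k).

Definition subset_mod (I : set (set nat)) (A B : set nat) : Prop :=
  I (A `\` B).

Definition cosmall_subset (I : set (set nat)) (A B : set nat) : Prop :=
  A `<=` B /\ I (B `\` A).

Definition b_bounded_mod (u : nat -> int) (I : set (set nat)) (X : set nat) :
    Prop :=
  exists2 A, b_bounded u A & cosmall_subset I A X.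

Definition t_ideal (R : realType) (u : nat -> int) (I : set (set nat)) :
    set (circle R) :=
  [set z | forall U, circle_nbhs 0 U -> I [set n | ~ U (z *~ u n)]].

(* Main.v *)
(* Writing r_n in [0,1[ for the remainder u_n (x - sum_(k<=n) c_k / u_k), one
   has u_n x = r_n mod 1 and b_{n+1} r_n = c_{n+1} + r_{n+1}; the point is
   I-topologically torsion iff, for every e > 0, r_n < e or r_n > 1 - e for
   I-almost all n. Since I is translation invariant, "for I-almost all n" is
   stable under shifting n.
   If S is b-bounded mod I, a nonzero c_{n+1} keeps r_n away from 0, hence r_n
   is near 1; then c_{n+1} = b_{n+1} - 1 and r_{n+1} is near 1, so that
   c_{n+2} is nonzero. If c_{n+1} = 0 with b_{n+1} bounded, then r_n, hence
   also r_{n+1} >= c_{n+2} / b_{n+2}, is near 0; a P-ideal turns this into a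
   limit along a subset.
   Conversely, (i) and (ii) make r_n close to 1 whenever n+1 is in S, and (a2)
   excludes that n is outside S with b_n bounded while n+1 is in S; so for the
   other n the remainder r_n is a long iterated quotient, hence small, unless
   some b_k just before the next element of S is already large. *)
Require Import Defs.
From HB Require Import structures.
From mathcomp Require Import all_boot all_order all_algebra.
From mathcomp Require Import generic_quotient ring_quotient.
From mathcomp Require Import all_classical all_reals all_analysis.
From mathcomp Require Import zify ring lra.

Set Implicit Arguments.
Unset Strict Implicit.
Unset Printing Implicit Defensive.

Import Order.TTheory GRing.Theory Num.Theory.
Import numFieldNormedType.Exports.

Local Open Scope classical_set_scope.
Local Open Scope ring_scope.

(** * Torsion in the circle, read off from real remainders *)

Lemma to_circle_mulrz (R : realType) (x : R) (m : int) :
  to_circle x *~ m = to_circle (x *~ m).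
Proof. by rewrite /to_circle raddfMz. Qed.

Lemma to_circle_eq (R : realType) (x y : R) :
  to_circle x = to_circle y <-> x - y \is a Num.int.
Proof.
have -> : (x - y \is a Num.int) = (x - y \in int_subgroup R) by [].
rewrite (Quotient.idealrBE (int_subgroup R)).
by split=> [/eqP|/eqP].
Qed.

(** Since [r n] represents the multiple of [x] by [u n], being near 0 in the circle means that [r n]
    is near an integer, hence near 0 or 1. *)
Lemma t_idealP (R : realType) (u : nat -> int) (I : set (set nat))
    (x : R) (r : nat -> R) :
  set_ideal I -> (forall n, 0 <= r n < 1) ->
  (forall n, to_circle x *~ u n = to_circle (r n)) ->
  t_ideal u I (to_circle x) <->
  forall e : R, 0 < e -> I [set n | ~ (r n < e \/ 1 - e < r n)].
Proof.
move=> [_ _ Isub] r01 xr; split=> [tx e e0|small U U0].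
  (* The preimage in [R] of this image of (-e, e) is a union of integer translates of an interval,
     hence open. *)
  pose U : set (circle R) := [set z | exists2 t : R, `|t| < e & z = to_circle t].
  have oU : @open (quotient_topology {ideal_quot (int_subgroup R)}) U.
    rewrite /open /= /quotient_open openE => y [t te yt].
    have {}yt : to_circle y = to_circle t by [].
    rewrite /interior /=; apply/nbhs_ballP; exists (e - `|t|) => /=.
      by rewrite subr_gt0.
    move=> z /=; rewrite -ball_normE /= => yz.
    exists (z - y + t).
      apply: le_lt_trans (ler_normD _ _) _.
      by rewrite -ltrBrDr distrC.
    apply/to_circle_eq; move/to_circle_eq: yt.
    by rewrite (_ : z - (z - y + t) = y - t) //; ring.
  have U0 : circle_nbhs 0 U.
    rewrite /circle_nbhs; apply: open_nbhs_nbhs; split => //.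
    by exists 0; rewrite ?normr0// /to_circle raddf0.
  apply: Isub (tx U U0) => n /=; apply: contra_not.
  rewrite xr => -[t te /to_circle_eq /intrP[k rk]].
  have /andP[r0 r1] := r01 n.
  have [e1|e1] := ltP 1 e; first by left; lra.
  have {te} [te1 te2] : - e < t /\ t < e by apply/andP; rewrite -ltr_norml.
  (* With [e <= 1] the integer [k = r n - t] lies strictly between -1 and 2; its values 0 and 1 give
     the two alternatives. *)
  have k0 : (-1)%:~R < (k%:~R : R) by rewrite -rk; lra.
  have k2 : (k%:~R : R) < 2%:~R by rewrite -rk; lra.
  rewrite !ltr_int in k0 k2.
  have [k0'|k1] : k = 0 \/ k = 1 by lia.
    by left; rewrite k0' in rk; lra.
  by right; rewrite k1 in rk; lra.
have : nbhs (0 : R) (to_circle (R:=R) @^-1` U).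
  apply: (@pi_continuous _ {ideal_quot (int_subgroup R)} 0).
  by move: U0; rewrite /circle_nbhs -(raddf0 \pi_({ideal_quot (int_subgroup R)})%qT).
move=> /nbhs_ballP[e /= e0 eU]; apply: Isub (small e e0) => n /=.
rewrite xr; apply: contra_not; have /andP[r0 r1] := r01 n; case=> rn.
  by apply: eU; rewrite -ball_normE /= sub0r normrN ger0_norm.
rewrite (_ : to_circle (r n) = to_circle (r n - 1)).
  by apply: eU; rewrite -ball_normE /= sub0r normrN ltr0_norm; lra.
by apply/to_circle_eq; rewrite opprB addrC subrK.
Qed.

(** * Arithmetic sequences, digits and remainders *)

Lemma finite_set_natP (A : set nat) :
  finite_set A <-> exists M, forall n, A n -> (n <= M)%N.
Proof.
split=> [/finite_seqP[s ->]|[M AM]].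
  by exists (\max_(i <- s) i)%N => n ns; exact: (@leq_bigmax_seq _ s predT id).
by apply: (sub_finite_set _ (finite_II M.+1)) => n /AM.
Qed.

Lemma arithmetic_seq_ge (u : nat -> int) :
  arithmetic_seq u -> forall n, n.+1%:Z <= u n.
Proof.
move=> [u_lt u0 _]; elim=> [|n IHn]; first by rewrite u0.
by have := u_lt n n.+1 (ltnSn n); lia.
Qed.

Lemma arithmetic_seqS (u : nat -> int) :
  arithmetic_seq u -> forall n, u n.+1 = quot_ratio u n.+1 * u n.
Proof. by move=> [_ _ u_dvd] n; rewrite /quot_ratio divzK. Qed.

Lemma quot_ratio_ge2 (u : nat -> int) :
  arithmetic_seq u -> forall n, 2 <= quot_ratio u n.+1.
Proof.
move=> hu n; have [u_lt _ _] := hu.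
have := u_lt n n.+1 (ltnSn n); rewrite (arithmetic_seqS hu).
by have := arithmetic_seq_ge hu n; nia.
Qed.

Lemma ltr_inv_arithmetic_seq (R : realType) (u : nat -> int) (a : R) (N : nat) :
  arithmetic_seq u -> 0 < a -> exists2 m, (N <= m)%N & (u m)%:~R^-1 < a.
Proof.
move=> hu a0; have [k] := ltr_add_invr a0; rewrite add0r => ka.
exists (maxn N k); first exact: leq_maxl.
apply: le_lt_trans ka; rewrite lef_pV2 ?posrE ?ltr0n//.
  have kle : k.+1%:Z <= u (maxn N k).
    by have := arithmetic_seq_ge hu (maxn N k); lia.
  by rewrite (_ : k.+1%:R = k.+1%:Z%:~R :> R)// ler_int.
by rewrite ltr0z; have := arithmetic_seq_ge hu (maxn N k); lia.
Qed.

(** Digits come from the floors [F n] of [u n] times [x]: the partial sums telescope to [F n / u n],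
    which is within [1 / u n] of [x]. *)
Lemma representation_exists (R : realType) (u : nat -> int) (x : R) :
  arithmetic_seq u -> 0 <= x -> x < 1 -> exists c, is_representation u x c.
Proof.
move=> hu x0 x1; have [_ u0 _] := hu.
have uge := arithmetic_seq_ge hu; have uS := arithmetic_seqS hu.
have bge := quot_ratio_ge2 hu.
pose F n : int := Num.floor ((u n)%:~R * x).
pose d n : int := F n.+1 - quot_ratio u n.+1 * F n.
have upos n : 0 < (u n)%:~R :> R by rewrite ltr0z; have := uge n; lia.
have F1 n : (F n)%:~R <= (u n)%:~R * x by exact: floor_le.
have F2 n : (u n)%:~R * x < (F n)%:~R + 1.
  by have /andP[_] := floor_itv ((u n)%:~R * x); rewrite intrD.
have uSR n : (u n.+1)%:~R = (quot_ratio u n.+1)%:~R * (u n)%:~R :> R.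
  by rewrite uS intrM.
have bgeR n : 2 <= (quot_ratio u n.+1)%:~R :> R by rewrite (ler_int R 2).
have d0 n : 0 <= d n.
  suff : -1 < d n by lia.
  rewrite -(ltr_int R) /d intrB intrM.
  by have := F2 n.+1; have := F1 n; have := bgeR n; rewrite uSR; nra.
have db n : d n < quot_ratio u n.+1.
  rewrite -(ltr_int R) /d intrB intrM.
  by have := F1 n.+1; have := F2 n; have := bgeR n; rewrite uSR; nra.
pose c n := if n is m.+1 then `|d m|%N else 0%N.
have cE n : (c n.+1)%:Z = d n by rewrite /= gez0_abs.
have sE n : series (fun n => (c n.+1)%:R / (u n.+1)%:~R : R) n =
            (F n)%:~R / (u n)%:~R.
  rewrite /series /=; elim: n => [|n IHn].
    rewrite big_nil /F u0 mul1r (floor_def (m := 0)) ?mul0r//.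
    by rewrite add0r x0.
  rewrite big_nat_recr//= {}IHn.
  have -> : (`|d n|%N)%:R = (d n)%:~R :> R by rewrite -[RHS]/((d n)%:~R) -cE.
  rewrite /d intrB intrM uSR; have := upos n; have := bgeR n => ? ?.
  by field; apply/andP; split; lra.
exists c; split => //.
- by case=> // n _; rewrite cE.
- move=> /finite_set_natP[M AM].
  have [N cN] : exists N, forall n, (N <= n)%N -> d n = quot_ratio u n.+1 - 1.
    exists M => n Mn; have := db n.
    have [//|] := boolP (d n < quot_ratio u n.+1 - 1); last lia.
    by rewrite -cE => lt; have := AM n.+1 (conj isT lt); lia.
  pose r n : R := (u n)%:~R * x - (F n)%:~R.
  (* If all digits after [N] were maximal, this quotient would be a positive constant, yet it is at
     most [1 / u m], which gets arbitrarily small. *)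
  have rN m : (N <= m)%N -> (1 - r m) / (u m)%:~R = (1 - r N) / (u N)%:~R.
    elim: m => [|m IHm]; first by rewrite leqn0 => /eqP ->.
    rewrite leq_eqVlt => /orP[/eqP -> //|Nm]; rewrite -IHm//.
    have FS : (F m.+1)%:~R = (quot_ratio u m.+1)%:~R * (F m)%:~R +
        (quot_ratio u m.+1)%:~R - 1 :> R.
      have := cN m Nm; rewrite /d => dE.
      by rewrite (_ : F m.+1 = quot_ratio u m.+1 * F m + quot_ratio u m.+1 - 1)
        ?intrD ?intrM//; lia.
    rewrite /r FS uSR; have := upos m; have := bgeR m => ? ?.
    by field; apply/andP; split; lra.
  have a0 : 0 < (1 - r N) / (u N)%:~R.
    by rewrite divr_gt0// /r; have := F2 N; lra.
  have [m Nm] := ltr_inv_arithmetic_seq N hu a0.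
  rewrite -(rN m Nm) ltr_pdivlMr// mulVf ?gt_eqF// /r.
  by have := F1 m; lra.
- apply/cvgrPdist_lt => e e0.
  have [N _ uN] := ltr_inv_arithmetic_seq 0 hu e0.
  exists N => //= n /= Nn; rewrite sE.
  apply: le_lt_trans uN.
  apply: (@le_trans _ _ (u n)%:~R^-1).
    have -> : x - (F n)%:~R / (u n)%:~R =
        ((u n)%:~R * x - (F n)%:~R) / (u n)%:~R.
      by have := upos n => ?; field; lra.
    rewrite ger0_norm; last by rewrite divr_ge0 ?(ltW (upos n))// subr_ge0.
    rewrite ler_pdivrMr// mulVf ?gt_eqF//.
    by have := F2 n; lra.
  rewrite lef_pV2 ?posrE// ler_int.
  have [u_lt _ _] := hu.
  by move: Nn; rewrite leq_eqVlt => /orP[/eqP->//|/u_lt /ltW].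
Qed.

(** Isolates the recurrence between digits and remainders from [u] and [x]. Ratios and digits are
    constrained only at [n.+1], as index 0 carries no digit. *)
Definition digit_expansion (R : realType) (b : nat -> int) (c : nat -> nat)
    (r : nat -> R) : Prop :=
  [/\ forall n, 2 <= b n.+1, forall n, (c n.+1)%:Z < b n.+1,
      forall n, 0 <= r n < 1
    & forall n, (b n.+1)%:~R * r n = (c n.+1)%:R + r n.+1].

(** The remainder is [u n] times the tail of the series; [u n] times the partial sum is an integer
    and vanishes in the circle. *)
Lemma representation_remainder (R : realType) (u : nat -> int) (x : R)
    (c : nat -> nat) :
  arithmetic_seq u -> is_representation u x c ->
  exists2 r : nat -> R, digit_expansion (quot_ratio u) c r &
    forall n, to_circle x *~ u n = to_circle (r n).
Proof.
move=> hu [_ cb cinf cvx].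
have uge := arithmetic_seq_ge hu; have uS := arithmetic_seqS hu.
have bge := quot_ratio_ge2 hu.
have upos n : 0 < (u n)%:~R :> R by rewrite ltr0z; have := uge n; lia.
have uSR n : (u n.+1)%:~R = (quot_ratio u n.+1)%:~R * (u n)%:~R :> R.
  by rewrite uS intrM.
have bgeR n : 2 <= (quot_ratio u n.+1)%:~R :> R by rewrite (ler_int R 2).
have cR n : (c n.+1)%:R <= (quot_ratio u n.+1)%:~R - 1 :> R.
  rewrite (_ : (c n.+1)%:R = (c n.+1)%:Z%:~R)// (_ : 1 = 1%:~R)// -intrB ler_int.
  by have := cb n.+1 isT; lia.
set f := (fun n => (c n.+1)%:R / (u n.+1)%:~R : R) in cvx.
have fge0 n : 0 <= f n by rewrite divr_ge0// ltW.
have sS n : series f n.+1 = series f n + f n.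
  by rewrite /series /= big_nat_recr.
pose r n := (u n)%:~R * (x - series f n).
have rS n : (quot_ratio u n.+1)%:~R * r n = (c n.+1)%:R + r n.+1.
  rewrite /r sS /f uSR; field.
  by rewrite !gt_eqF// (lt_le_trans _ (bgeR n)).
have limx : limn (series f) = x by apply/cvg_lim.
have cvf : cvgn (series f) by apply/cvg_ex; exists x.
have r_ge0 n : 0 <= r n.
  rewrite mulr_ge0 ?(ltW (upos n))// subr_ge0 -limx.
  apply: nondecreasing_cvgn_le => //; apply/nondecreasing_seqP => k.
  by rewrite sS lerDl.
have r_le1 n : r n <= 1.
  (* A digit is at most the ratio minus 1, so the partial sum plus [1 / u n] never increases and
     bounds the limit [x] from above. *)
  have decr m : (n <= m)%N ->
      series f m + (u m)%:~R^-1 <= series f n + (u n)%:~R^-1.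
    elim: m => [|m IHm]; first by rewrite leqn0 => /eqP ->.
    rewrite leq_eqVlt => /orP[/eqP -> //|nm].
    apply: le_trans (IHm nm); rewrite sS -addrA lerD2l /f uSR.
    have := upos m; have := bgeR m => ? ?; have := cR m => ?.
    rewrite -[X in _ + X]div1r -mulrDl ler_pdivrMr ?mulr_gt0//; last lra.
    by rewrite mulrCA mulVf ?gt_eqF// mulr1; lra.
  rewrite /r mulrC -ler_pdivlMr// lerBlDr addrC div1r -limx.
  apply: limr_le => //; exists n => // m /= /decr; apply: le_trans.
  by rewrite lerDl invr_ge0 ltW.
have r_lt1 n : r n < 1.
  rewrite lt_neqAle r_le1 andbT; apply/eqP => rn1; apply: cinf.
  apply/finite_set_natP; exists n => m [].
  (* A remainder equal to 1 propagates through the recurrence and makes every later digit maximal,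
     against [cinf]. *)
  have rm1 k : r (n + k)%N = 1 /\
      (c (n + k).+1)%:R = (quot_ratio u (n + k).+1)%:~R - 1 :> R.
    have step j : r j = 1 -> (c j.+1)%:R = (quot_ratio u j.+1)%:~R - 1 :> R.
      have := rS j; have := cR j; have := r_le1 j.+1 => ? ? + rj.
      by rewrite rj; lra.
    have H : r (n + k)%N = 1.
      elim: k => [|k IHk]; first by rewrite addn0.
      by rewrite addnS; have := rS (n + k)%N; rewrite (step _ IHk) IHk; lra.
    by split; [|exact: step].
  case: m => // m _ cm; rewrite leqNgt; apply/negP => nm.
  have [_] := rm1 (m - n)%N; rewrite subnKC// => /eqP.
  rewrite (_ : (c m.+1)%:R = (c m.+1)%:Z%:~R)// (_ : 1 = 1%:~R)// -intrB eqr_int.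
  by move=> /eqP cE; rewrite cE ltxx in cm.
have us_int n : (u n)%:~R * series f n \is a Num.int.
  elim: n => [|n IHn]; first by rewrite /series /= big_nil mulr0.
  rewrite sS mulrDr; apply: rpredD.
    by rewrite uSR -mulrA; apply: rpredM; first exact: intr_int.
  by rewrite /f mulrCA divff ?gt_eqF// mulr1 natr_int.
exists r; first by split => // n; [exact: cb|rewrite r_ge0 r_lt1].
move=> n; rewrite to_circle_mulrz; apply/to_circle_eq.
by rewrite /r mulrBr mulrzl opprB addrC subrK.
Qed.

(** * Properties of [I]-almost all indices, as a filter *)

Definition dual_filter (I : set (set nat)) : set_system nat :=
  [set A | I (~` A)].

Lemma dual_filter_filter (I : set (set nat)) :
  set_ideal I -> Filter (dual_filter I).
Proof.
move=> [[A0 IA0] IU Isub]; split.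
- by rewrite /dual_filter /= setCT; apply: Isub IA0.
- by move=> A B IA IB; rewrite /dual_filter /= setCI; apply: IU.
- by move=> A B AB; apply: Isub => n /=; apply: contra_not; exact: AB.
Qed.

Lemma dual_filterN (I : set (set nat)) (A : set nat) :
  dual_filter I (fun n => ~ A n) <-> I A.
Proof. by rewrite /dual_filter /= (_ : ~` _ = A)//; exact: setCK. Qed.

(** Translation by 1 misses index 0, which freeness restores; translation by -1 merely drops it. *)
Lemma dual_filterS (I : set (set nat)) (P : set nat) :
  set_ideal I -> free_ideal I -> translation_invariant I ->
  dual_filter I (fun n => P n.+1) <-> dual_filter I P.
Proof.
move=> [_ IU Isub] Ifree Itr; split=> IP.
  apply: Isub (IU _ _ (Ifree [set 0%N] (finite_set1 _)) (Itr _ 1 IP)).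
  by case=> [|n] nP; [left|right; exists n => //; lia].
apply: Isub (Itr _ (-1) IP) => n nP.
by exists n.+1 => //; lia.
Qed.

Lemma dual_filter_ge (I : set (set nat)) (N : nat) :
  free_ideal I -> dual_filter I (fun n => (N <= n)%N).
Proof.
move=> Ifree; apply: Ifree; apply/finite_set_natP; exists N => n /= /negP.
by lia.
Qed.

(** * Estimates at a single index of an expansion *)

Section Expansion.
Context {R : realType} {b : nat -> int} {c : nat -> nat} {r : nat -> R}.
Context (bcr : digit_expansion b c r).

Lemma ratio_ge2 n : 2 <= (b n.+1)%:~R :> R.
Proof. by case: bcr => b2 _ _ _; rewrite (ler_int R 2). Qed.

Lemma digit_le n : (c n.+1)%:R <= (b n.+1)%:~R - 1 :> R.
Proof.
case: bcr => _ cb _ _.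
rewrite (_ : (c n.+1)%:R = (c n.+1)%:Z%:~R)// (_ : 1 = 1%:~R)// -intrB ler_int.
by have := cb n; lia.
Qed.

Lemma digit_max n :
  (c n.+1)%:Z = b n.+1 - 1 <-> (b n.+1)%:~R - 2 < (c n.+1)%:R :> R.
Proof.
case: bcr => _ cb _ _.
rewrite (_ : (c n.+1)%:R = (c n.+1)%:Z%:~R)// (_ : 2 = 2%:~R)// -intrB ltr_int.
by have := cb n; split; lia.
Qed.

Lemma digit_maxE n : (c n.+1)%:Z = b n.+1 - 1 ->
  (c n.+1)%:R = (b n.+1)%:~R - 1 :> R.
Proof. by move=> cE; rewrite (_ : (c n.+1)%:R = (c n.+1)%:Z%:~R)// cE intrB. Qed.

Lemma remainder_lt_half n : c n.+1 = 0%N -> r n < 2^-1.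
Proof.
case: bcr => _ _ r01 rS c0; have := rS n; rewrite c0 add0r.
have /andP[? ?] := r01 n; have /andP[_ ?] := r01 n.+1.
by have := ratio_ge2 n; nra.
Qed.

(** A nonzero digit forces [r n >= 1 / M > e], so [r n > 1 - e]. As [e] is at most [1 / (2 M)], the
    digit exceeds [b n.+1 - 2] and [r n.+1 > 1 / 2], which a zero next digit would forbid. *)
Lemma remainder_near1 n (M e : R) :
  c n.+1 <> 0%N -> (b n.+1)%:~R <= M -> e * (2 * M) <= 1 ->
  r n < e \/ 1 - e < r n ->
  (c n.+1)%:Z = b n.+1 - 1 /\ c n.+2 <> 0%N.
Proof.
case: bcr => _ _ r01 rS c0 bM eM rn.
have c1 : 1 <= (c n.+1)%:R :> R by rewrite ler1n; case: (c n.+1) c0.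
have b2 := ratio_ge2 n; have crS := rS n.
have /andP[r0 r1] := r01 n; have /andP[s0 s1] := r01 n.+1.
have cle := digit_le n.
case: rn => rn; first by exfalso; clear c0; nra.
clear c0; split; first by apply/digit_max; nra.
by move/remainder_lt_half; nra.
Qed.

(** A zero digit keeps [r n] away from 1, so [r n.+1 = b n.+1 * r n < M * e], and [r n.+1] bounds
    the quotient. *)
Lemma quotient_lt n (M e : R) :
  c n.+1 = 0%N -> (b n.+1)%:~R <= M -> e <= 2^-1 ->
  r n < e \/ 1 - e < r n ->
  (c n.+2)%:R / (b n.+2)%:~R < M * e.
Proof.
case: bcr => _ _ r01 rS c0 bM e2 rn.
have rn2 := remainder_lt_half c0.
have {rn}rn : r n < e by case: rn => //; lra.
have := rS n; rewrite c0 add0r => rSn.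
have b2 := ratio_ge2 n; have b2' := ratio_ge2 n.+1.
have /andP[r0 r1] := r01 n; have /andP[s0 s1] := r01 n.+2.
apply: (@le_lt_trans _ _ (r n.+1)); last by nra.
rewrite ler_pdivrMr; last lra.
by rewrite mulrC rS lerDl.
Qed.

(** * Estimates along a shift-invariant filter *)

Context (F : set_system nat) (FF : Filter F).
Context (FS : forall P : set nat, F (fun n => P n.+1) <-> F P).

Lemma support_digit_max (M : R) :
  F (fun n => c n.+1 <> 0%N -> (b n.+1)%:~R <= M) ->
  (forall e, 0 < e -> F (fun n => r n < e \/ 1 - e < r n)) ->
  F (fun n => c n.+1 <> 0%N -> (c n.+1)%:Z = b n.+1 - 1 /\ c n.+2 <> 0%N).
Proof.
(* [M] may be nonpositive, hence [|M| + 1]; the tolerance is the largest that [remainder_near1]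
   admits for this bound. *)
move=> bM tF; have M0 : 0 < 2 * (`|M| + 1) by have := normr_ge0 M; lra.
have e0 : 0 < (2 * (`|M| + 1))^-1 by rewrite invr_gt0.
apply: filterS2 bM (tF _ e0) => n bM rn c0.
apply: (remainder_near1 (M := `|M| + 1) c0 _ _ rn).
  by have := ler_norm M; have := bM c0; lra.
by rewrite mulVf ?gt_eqF.
Qed.

Lemma quotient_small (A : set nat) (M : R) :
  (forall n, A n.+1 -> (b n.+1)%:~R <= M) ->
  F (fun n => A n.+1 -> c n.+1 = 0%N) ->
  (forall e, 0 < e -> F (fun n => r n < e \/ 1 - e < r n)) ->
  forall e, 0 < e -> F (fun n => A n -> (c n.+1)%:R / (b n.+1)%:~R < e :> R).
Proof.
(* After the shift [A] is tested at [n.+1], so [r n] controls the quotient at [n.+2]. *)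
move=> bM Ac tF e e0; apply/FS.
have M0 : 0 < `|M| + 1 by have := normr_ge0 M; lra.
pose d := Num.min 2^-1 (e / (`|M| + 1)).
have d0 : 0 < d by rewrite lt_min divr_gt0// andbT invr_gt0.
apply: filterS2 Ac (tF _ d0) => n Ac rn An.
have bn : (b n.+1)%:~R <= `|M| + 1 by have := ler_norm M; have := bM n An; lra.
apply: lt_le_trans (quotient_lt (Ac An) bn _ rn) _; first by rewrite ge_min lexx.
by rewrite mulrC -ler_pdivlMr// ge_min lexx orbT.
Qed.

(** A maximal digit gives [1 - r n = (1 - r n.+1) / b n.+1], at most half the distance to 1 at the
    next index, whose digit is again nonzero. *)
Lemma remainder_to1 :
  F (fun n => c n.+1 <> 0%N -> (c n.+1)%:Z = b n.+1 - 1 /\ c n.+2 <> 0%N) ->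
  forall k, F (fun n => c n.+1 <> 0%N -> 1 - 2^-1 ^+ k <= r n).
Proof.
case: bcr => _ _ r01 rS FcS; elim=> [|k /(FS _).2 IHk].
  by apply: filterE => n _; rewrite expr0 subrr; have /andP[] := r01 n.
apply: filterS2 FcS IHk => n cS IHn c0.
have [/digit_maxE cE /IHn] := cS c0; have := rS n; rewrite cE exprS.
have : 0 <= 2^-1 ^+ k :> R by rewrite exprn_ge0 ?invr_ge0.
move: (2^-1 ^+ k) => h h0 rn; have := ratio_ge2 n; have /andP[_ ?] := r01 n.
by nra.
Qed.

(* By induction on k: almost every remainder is below max(e, 2^-k) or above
   1 - e. If c_{n+1} = 0 then r_{n+1} = b_{n+1} r_n, so r_n >= e forces
   b_{n+1} <= 1/e, and the second hypothesis makes c_{n+2} vanish too; hence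
   r_{n+1} < 1/2 is below max(e, 2^-k) and r_n is at most half of it. *)
Lemma remainder_small_or_near1 :
  F (fun n => c n.+1 <> 0%N -> (c n.+1)%:Z = b n.+1 - 1 /\ c n.+2 <> 0%N) ->
  (forall M : int, F (fun n => c n.+1 = 0%N -> b n.+1 <= M -> c n.+2 = 0%N)) ->
  forall e, 0 < e -> F (fun n => r n < e \/ 1 - e < r n).
Proof.
move=> FcS Fc0 e0 e0_gt0; case: (bcr) => _ _ r01 rS.
(* With [e <= 1 / 2], a remainder below one half cannot exceed [1 - e]. *)
wlog : e0 e0_gt0 / e0 <= 2^-1.
  move=> wl; have [/(wl _ e0_gt0)//|e2] := leP e0 2^-1.
  apply: filterS (wl 2^-1 _ (lexx _)); last by rewrite invr_gt0.
  by move=> n [?|?]; [left|right]; lra.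
move: e0 e0_gt0 => e e_gt0 e2.
have [m em] : exists m, 2^-1 ^+ m < e.
  have /cvgrPdist_lt/(_ e e_gt0)[m _ /(_ m (leqnn m)) /=] :
      (fun n => 2^-1 ^+ n : R) @ \oo --> (0 : R).
    by apply: cvg_expr; rewrite ger0_norm; lra.
  by rewrite sub0r normrN ger0_norm ?exprn_ge0 ?invr_ge0//; exists m.
suff H k : F (fun n => r n < Num.max e (2^-1 ^+ k) \/ 1 - e < r n).
  by apply: filterS (H m) => n; rewrite (max_idPl _)// ltW.
pose M := Num.ceil e^-1.
elim: k => [|k /(FS _).2 IHk].
  apply: filterE => n; left; rewrite expr0 lt_max.
  by have /andP[_ ->] := r01 n; rewrite orbT.
apply: filterS3 (remainder_to1 FcS m) (Fc0 M) IHk => n r1 c0 IHn.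
have [cn|/eqP cn] := eqVneq (c n.+1) 0%N; last first.
  by right; have := r1 cn; lra.
left; rewrite lt_max; apply/orP.
have := rS n; rewrite cn add0r => rSn; have b2 := ratio_ge2 n.
have /andP[r0 _] := r01 n; have /andP[s0 s1] := r01 n.+1.
have [bM|Mb] := leP (b n.+1) M; last first.
  left; have : e^-1 < (b n.+1)%:~R.
    by apply: le_lt_trans (ceil_ge _) _; rewrite ltr_int.
  rewrite invf_plt ?posrE//; last lra.
  by apply: le_lt_trans; rewrite -[_^-1]mul1r ler_pdivlMr; lra.
have := remainder_lt_half (c0 cn bM).
have : 0 <= 2^-1 ^+ k :> R by rewrite exprn_ge0 ?invr_ge0.
rewrite exprS => h0 half.
case: IHn => [|?]; last lra.
by rewrite lt_max => /orP[re|rk]; [left|right]; nra.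
Qed.

End Expansion.

(** * From P-ideals to limits, and the characterization *)

(** The level sets [E k] lie in [I]; removing one [B] in [I] that almost contains each of them
    leaves only finitely many points of every level. *)
Lemma P_ideal_cvg0 (R : realType) (I : set (set nat)) (A : set nat)
    (f : nat -> R) :
  set_ideal I -> P_ideal I -> (forall n, 0 <= f n) ->
  (forall e, 0 < e -> dual_filter I (fun n => A n -> f n < e)) ->
  exists2 A', cosmall_subset I A' A & f @ within A' \oo --> (0 : R).
Proof.
move=> I_ideal IP f0 If; have [_ _ Isub] := I_ideal.
have FF := dual_filter_filter I_ideal.
pose E k := [set n | A n /\ k.+1%:R^-1 <= f n].
have IE k : I (E k).
  have k0 : 0 < k.+1%:R^-1 :> R by rewrite invr_gt0.
  apply/dual_filterN; apply: filterS (If _ k0) => n AP [An].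
  by rewrite leNgt AP.
have [B IB EB] := IP E IE.
exists (A `\` B).
  split; first by move=> n [].
  by apply: Isub IB => n [An]; apply: contra_notP.
apply/cvgrPdist_lt => e e0; rewrite near_withinE.
have [k] := ltr_add_invr e0; rewrite add0r => ke.
have /finite_set_natP[M EM] := EB k.
exists M.+1 => // n /= Mn [An Bn]; rewrite sub0r normrN ger0_norm//.
rewrite ltNge; apply/negP => en.
have := EM n (conj (conj An (le_trans (ltW ke) en)) Bn).
by rewrite leqNgt Mn.
Qed.

Theorem theorem1p8 (R : realType) (u : nat -> int) (I : set (set nat)) (x : R)
    (u_arith : arithmetic_seq u)
    (I_ideal : set_ideal I) (I_free : free_ideal I) (I_P : P_ideal I)
    (I_transl : translation_invariant I)
    (x_ge0 : 0 <= x) (x_lt1 : x < 1)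
    (S_bounded : b_bounded_mod u I (supp u x)) :
  t_ideal u I (to_circle x) <->
  [/\ subset_mod I (translate (supp u x) 1) (supp u x),
      cosmall_subset I (supp_b u x) (supp u x)
    & forall A : set nat, b_bounded u A -> ~ I A -> I (A `&` supp u x) ->
        exists2 A' : set nat, cosmall_subset I A' A &
          (fun n => (digit u x n.+1)%:R / (quot_ratio u n.+1)%:~R : R)
            @ within A' \oo --> (0 : R)].
Proof.
have cP : is_representation u x (digit u x).
  by apply: xgetPex; exact: representation_exists.
have [r bcr xr] := representation_remainder u_arith cP.
have [b2 _ r01 _] := bcr.
have [_ _ Isub] := I_ideal.
have FF := dual_filter_filter I_ideal.
have FS P := dual_filterS P I_ideal I_free I_transl.
have b_gt0 n : 0 < (quot_ratio u n.+1)%:~R :> R.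
  by rewrite ltr0z; have := b2 n; lia.
have SbS : supp_b u x `<=` supp u x.
  by case=> [[]//|n [_ cb]]; split => //; have := b2 n; lia.
apply: (iff_trans (t_idealP I_ideal r01 xr)).
split=> [tF|[Si Sii Sa2]].
  have [A0 [M A0M] [_ SA0]] := S_bounded.
  have bM : dual_filter I (fun n =>
      digit u x n.+1 <> 0%N -> (quot_ratio u n.+1)%:~R <= M%:~R :> R).
    move: SA0 => /(dual_filterN _ _).2/(FS _).2; apply: filterS => n SA0 c0.
    by rewrite ler_int; apply: A0M => //; apply: contra_notP SA0.
  have FcS := support_digit_max bcr FF bM tF.
  split.
  (* Two shifts test [S + 1] at [n.+2], whose predecessor [n.+1] is the index treated by [FcS]. *)
  - rewrite /subset_mod; apply/dual_filterN/(FS _).1/(FS _).1.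
    apply: filterS FcS => n FcS [[a [_ ca] an]].
    have an1 : a = n.+1 by lia.
    by move: ca; rewrite an1 => /FcS[_ c2]; case; split.
  - split=> //; apply/dual_filterN/(FS _).1.
    by apply: filterS FcS => n FcS [[_ /FcS[cE _]]]; case.
  - move=> A [N AN] _ /(dual_filterN _ _).2/(FS _).2 IAS.
    apply: P_ideal_cvg0 => //.
      by move=> n; rewrite divr_ge0// ltW.
    apply: (quotient_small bcr FF FS (M := N%:~R) _ _ tF).
      by move=> n An; rewrite ler_int; exact: AN.
    by apply: filterS IAS => n nAS An; apply: contra_notP nAS.
have FcS : dual_filter I (fun n => digit u x n.+1 <> 0%N ->
    (digit u x n.+1)%:Z = quot_ratio u n.+1 - 1 /\ digit u x n.+2 <> 0%N).
  move: Si Sii; rewrite /subset_mod => /(dual_filterN _ _).2/(FS _).2/(FS _).2 Si.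
  move=> [_ /(dual_filterN _ _).2/(FS _).2].
  apply: filterS2 Si => n Si Sii c0; split.
    by apply: contra_notP Sii => cE; split=> // -[].
  by apply: contra_not Si => c2; split; [exists n.+1 => //; lia|case].
apply: (remainder_small_or_near1 bcr FF FS FcS) => M.
(* The zero digits with ratio at most [M]: disjoint from the support by construction. If [A] is in
   [I], the goal holds vacuously almost everywhere; otherwise (a2) applies. *)
pose A := [set n | (0 < n)%N /\ digit u x n = 0%N /\ quot_ratio u n <= M].
have A_bounded : b_bounded u A by exists M => n [_ []].
have IAS : I (A `&` supp u x).
  by apply: Isub (I_free _ (@finite_set0 _)) => n [[_ [cn _]] [_ /(_ cn)]].
have [IA|nIA] := pselect (I A).
  move: IA => /(dual_filterN _ _).2/(FS _).2; apply: filterS => n nA cn bn.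
  by case: nA.
have [A' [A'A /(dual_filterN _ _).2 AA'] cvA'] := Sa2 A A_bounded nIA IAS.
have [N _ NA'] : \forall n \near \oo, A' n ->
    (digit u x n.+1)%:R / (quot_ratio u n.+1)%:~R < 2^-1 :> R.
  have /cvgrPdist_lt/(_ 2^-1) := cvA'; rewrite near_withinE.
  have -> : 0 < 2^-1 :> R by rewrite invr_gt0.
  move=> /(_ isT); apply: filterS => n NA' /NA'.
  by rewrite sub0r normrN ger0_norm// divr_ge0// ltW.
move: AA' => /(FS _).2; have geN := (FS _).2 (dual_filter_ge N I_free).
(* A nonzero digit at [n.+2] would be maximal, so its quotient would be at least 1/2, as the ratio
   is at least 2; this contradicts the choice of [N]. *)
apply: filterS3 geN ((FS _).2 FcS) => n Nn cS AA' cn bn.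
have A'n : A' n.+1 by apply: contra_notP AA'.
apply/eqP; apply: contraT => /eqP c2.
have [/(digit_maxE (R := R)) cE _] := cS c2.
have := NA' n.+1 Nn A'n; rewrite ltr_pdivrMr// cE.
by have := ratio_ge2 bcr n.+1; lra.
Qed.
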